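(* Let $K$ be a field and let $\phi:\mathfrak g\to\mathfrak h$ be a homomorphism of Lie algebras over $K$. Then $\operatorname{hd}(\phi)\le\operatorname{cd}(\phi)$.
   Context: Lie algebras are over a field $K$ and may be infinite-dimensional. Modules over a Lie algebra $\mathfrak g$ are left $\mathfrak g$-modules, equivalently left modules over the universal enveloping algebra $U(\mathfrak g)$ (no finiteness assumption). $H_n(\mathfrak g,M)$ and $H^n(\mathfrak g,M)$ denote Chevalley--Eilenberg homology and cohomology (equivalently $\operatorname{Tor}_n^{U(\mathfrak g)}(K,M)$ and $\operatorname{Ext}^n_{U(\mathfrak g)}(K,M)$). For a Lie algebra homomorphism $\phi:\mathfrak g\to\mathfrak h$ and an $\mathfrak h$-module $M$, regarded as a $\mathfrak g$-module by restriction along $\phi$, there are induced maps $\phi^*:H^n(\mathfrak h,M)\to H^n(\mathfrak g,M)$ and $\phi_*:H_n(\mathfrak g,M)\to H_n(\mathfrak h,M)$ for each $n\ge 0$. Define $$\operatorname{cd}(\phi)=\sup\{n\ge 0:\ \text{there is an }\mathfrak h\text{-module }M\text{ with }\phi^*:H^n(\mathfrak h,M)\to H^n(\mathfrak g,M)\text{ nonzero}\},$$ $$\operatorname{hd}(\phi)=\sup\{n\ge 0:\ \text{there is an }\mathfrak h\text{-module }M\text{ with }\phi_*:H_n(\mathfrak g,M)\to H_n(\mathfrak h,M)\text{ nonzero}\},$$ values in $\{0,1,2,\dots\}\cup\{\infty\}$. *)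

(* Defs.v *)
From HB Require Import structures.
From mathcomp Require Import freeg.
From mathcomp Require Import all_boot all_order all_algebra.
From mathcomp Require Import boolp classical_sets functions constructive_ereal.

Set Implicit Arguments.
Unset Strict Implicit.
Unset Printing Implicit Defensive.

Import Order.TTheory GRing.Theory Num.Theory.

Local Open Scope ring_scope.
Local Open Scope quotient_scope.
Local Open Scope classical_set_scope.

HB.mixin Record isLieAlgebra (K : fieldType) g of GRing.Lmodule K g := {
  lie : g -> g -> g;
  lie_linearl : forall y : g, linear (lie^~ y);
  lie_linearr : forall x : g, linear (lie x);
  liexx : forall x : g, lie x x = 0;
  lie_jacobi : forall x y z : g,
    lie x (lie y z) + lie y (lie z x) + lie z (lie x y) = 0
}.

#[short(type="lieAlgType")]
HB.structure Definition LieAlgebra (K : fieldType) :=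
  {g of isLieAlgebra K g & GRing.Lmodule K g}.

HB.mixin Record isLieMorphism (K : fieldType) (g h : lieAlgType K)
    (phi : g -> h) := {
  lie_morph : forall x y : g, phi (lie x y) = lie (phi x) (phi y)
}.

HB.structure Definition LieMorphism (K : fieldType) (g h : lieAlgType K) :=
  {phi of @isLieMorphism K g h phi & @GRing.Linear K g h *:%R phi}.

Notation "{ 'lie' g -> h }" := (@LieMorphism.type _ g%type h%type)
  (at level 0, g at level 98, h at level 99, format "{ 'lie'  g  ->  h }")
  : type_scope.

Record lieModule (K : fieldType) (g : lieAlgType K) (M : lmodType K) :=
  LieModule {
    lact :> g -> M -> M;
    lact_linearl : forall m : M, linear (lact^~ m);
    lact_linearr : forall x : g, linear (lact x);
    lact_lie : forall (x y : g) (m : M),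
      lact (lie x y) m = lact x (lact y m) - lact y (lact x m)
  }.

Section Restriction.
Context (K : fieldType) (g h : lieAlgType K) (phi : {lie g -> h}).
Context (M : lmodType K) (rho : lieModule h M).

Let ract (x : g) (m : M) : M := rho (phi x) m.

Fact ract_linearl m : linear (ract^~ m).
Proof. by move=> a x y; rewrite /ract linearP lact_linearl. Qed.

Fact ract_linearr x : linear (ract x).
Proof. by move=> a u v; rewrite /ract lact_linearr. Qed.

Fact ract_lie x y m :
  ract (lie x y) m = ract x (ract y m) - ract y (ract x m).
Proof. by rewrite /ract lie_morph lact_lie. Qed.

Definition lrestrict : lieModule g M :=
  LieModule ract_linearl ract_linearr ract_lie.

End Restriction.

Record subgroup (V : zmodType) := Subgroup {
  sg_set :> V -> Prop;
  sg0 : sg_set 0;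
  sgB : forall u v, sg_set u -> sg_set v -> sg_set (u - v)
}.

Section Subquotient.
Context (V : zmodType).

Definition sgmem (S : subgroup V) : {pred V} := fun v => `[< S v >].

Fact sgmem_closed S : zmod_closed (sgmem S).
Proof.
split=> [|u v]; rewrite !unfold_in; first by apply/asboolP; exact: sg0.
by move=> /asboolP Su /asboolP Sv; apply/asboolP; exact: sgB.
Qed.

HB.instance Definition _ S :=
  GRing.isZmodClosed.Build V (sgmem S) (sgmem_closed S).

Definition sgtype (S : subgroup V) := {v : V | v \in sgmem S}.
HB.instance Definition _ S := SubChoice.on (sgtype S).
HB.instance Definition _ S := [SubChoice_isSubZmodule of sgtype S by <:].

Fact sgtypeP (S : subgroup V) (z : sgtype S) : S (val z).
Proof. by apply/asboolP; exact: (valP z). Qed.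

Definition insg (S : subgroup V) v (Sv : S v) : sgtype S :=
  Sub v (introT (asboolP _) Sv).

Definition sgsub (Z B : subgroup V) : {pred sgtype Z} :=
  fun z => val z \in sgmem B.

Fact sgsubE Z B z : (z \in @sgsub Z B) = (val z \in sgmem B).
Proof. by []. Qed.

Fact sgsub_closed Z B : zmod_closed (@sgsub Z B).
Proof.
split=> [|u v]; rewrite !sgsubE ?raddf0 ?rpred0 //.
by move=> Bu Bv; rewrite raddfB rpredB.
Qed.

HB.instance Definition _ Z B :=
  GRing.isZmodClosed.Build (sgtype Z) (@sgsub Z B) (sgsub_closed Z B).

(* Z / (B \cap Z); for the (co)cycles and (co)boundaries below, B is contained
   in Z. Only the underlying abelian group of a (co)homology space is kept:
   this is enough to tell whether a linear map vanishes. *)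
Definition subquot (Z B : subgroup V) := {ideal_quot (@sgsub Z B)}.

Definition sqclass (Z B : subgroup V) v (Zv : Z v) : subquot Z B :=
  \pi_(subquot Z B) (insg Zv).

End Subquotient.

Section SubquotientMap.
Context (V V' : zmodType) (Z B : subgroup V) (Z' B' : subgroup V').
Context (f : V -> V') (fZ : forall v, Z v -> Z' (f v)).

Definition sqmap (q : subquot Z B) : subquot Z' B' :=
  sqclass B' (fZ (sgtypeP (repr q))).

Lemma sqmapE (fB : forall u v, B (u - v) -> B' (f u - f v)) v (Zv : Z v) :
  sqmap (sqclass B Zv) = sqclass B' (fZ Zv).
Proof.
apply/eqP; rewrite -Quotient.idealrBE; apply/asboolP.
have : repr (sqclass B Zv) - insg Zv \in @sgsub V Z B.
  by rewrite Quotient.idealrBE reprK.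
by move=> /asboolP; rewrite !raddfB /=; exact: fB.
Qed.

End SubquotientMap.

Section Tuples.
Context (T : Type).

Definition tomit n (i : 'I_n.+1) (x : {ffun 'I_n.+1 -> T}) :
  {ffun 'I_n -> T} := [ffun k => x (lift i k)].

Definition tcons n (a : T) (x : {ffun 'I_n -> T}) : {ffun 'I_n.+1 -> T} :=
  [ffun k => if unlift ord0 k is Some k' then x k' else a].

Definition tset n (x : {ffun 'I_n -> T}) (i : 'I_n) (a : T) :
  {ffun 'I_n -> T} := [ffun k => if k == i then a else x k].

Definition tmap (T' : Type) (f : T -> T') n (x : {ffun 'I_n -> T}) :
  {ffun 'I_n -> T'} := [ffun k => f (x k)].

End Tuples.

Lemma tmap_omit T T' (f : T -> T') n i (x : {ffun 'I_n.+1 -> T}) :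
  tmap f (tomit i x) = tomit i (tmap f x).
Proof. by apply/ffunP => k; rewrite !ffunE. Qed.

Lemma tmap_cons T T' (f : T -> T') n a (x : {ffun 'I_n -> T}) :
  tmap f (tcons a x) = tcons (f a) (tmap f x).
Proof. by apply/ffunP => k; rewrite !ffunE; case: unliftP => *; rewrite ?ffunE. Qed.

Lemma tmap_set T T' (f : T -> T') n (x : {ffun 'I_n -> T}) i a :
  tmap f (tset x i a) = tset (tmap f x) i (f a).
Proof. by apply/ffunP => k; rewrite !ffunE; case: eqP. Qed.

Section Bracket.
Context (K : fieldType) (g : lieAlgType K).

(* For i < j one has lift j i = i, so this is the tuple
   ([x_i, x_j], x_0, .., x_i omitted, .., x_j omitted, .., x_n). *)
Definition tbracket n (j : 'I_n.+2) (i : 'I_n.+1) (x : {ffun 'I_n.+2 -> g}) :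
    {ffun 'I_n.+1 -> g} :=
  tcons (lie (x (lift j i)) (x j)) (tomit i (tomit j x)).

End Bracket.

Lemma tmap_bracket (K : fieldType) (g h : lieAlgType K) (phi : {lie g -> h})
    n (j : 'I_n.+2) i x :
  tmap phi (tbracket j i x) = tbracket j i (tmap phi x).
Proof. by rewrite /tbracket tmap_cons !tmap_omit lie_morph !ffunE. Qed.

Section Cochains.
Context (K : fieldType) (g : lieAlgType K) (M : lmodType K).
Implicit Type n : nat.

Definition multilinear n (f : {ffun 'I_n -> g} -> M) :=
  forall x i, linear (fun a => f (tset x i a)).

Definition alternating n (f : {ffun 'I_n -> g} -> M) :=
  forall (x : {ffun 'I_n -> g}) i j, i != j -> x i = x j -> f x = 0.

(* Hom_K(\Lambda^n g, M) *)
Definition cochain n : set ({ffun 'I_n -> g} -> M) :=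
  [set f | multilinear f /\ alternating f].

Context (rho : lieModule g M).

Definition cobracket n :
    ({ffun 'I_n -> g} -> M) -> {ffun 'I_n.+1 -> g} -> M :=
  match n with
  | 0 => fun _ _ => 0
  | m.+1 => fun f x => \sum_(j < m.+2) \sum_(i < m.+1 | (i < j)%N)
                         (-1) ^+ (i + j) *: f (tbracket j i x)
  end.

(* (df)(x_0, .., x_n) = \sum_i (-1)^i x_i f(.. omit x_i ..)
     + \sum_(i < j) (-1)^(i+j) f([x_i, x_j], .. omit x_i, x_j ..) *)
Definition codiff n (f : {ffun 'I_n -> g} -> M) (x : {ffun 'I_n.+1 -> g}) : M :=
  \sum_(i < n.+1) (-1) ^+ i *: rho (x i) (f (tomit i x)) + cobracket f x.

Definition cocycle n : set ({ffun 'I_n -> g} -> M) :=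
  [set f | cochain f /\ codiff f = 0].

Definition coboundary n : set ({ffun 'I_n -> g} -> M) :=
  match n with
  | 0 => [set 0]
  | m.+1 => [set codiff f | f in @cochain m]
  end.

Fact cochain0 n : @cochain n 0.
Proof. by split=> [x i a u v|//]; rewrite scaler0 addr0. Qed.

Fact cochainB n f1 f2 : @cochain n f1 -> @cochain n f2 -> cochain (f1 - f2).
Proof.
move=> [l1 a1] [l2 a2]; split=> [x i a u v|x i j ij xij].
  rewrite !fctE /= l1 l2 scalerBr opprD !addrA.
  by congr (_ + _); rewrite addrAC.
by rewrite !fctE (a1 _ _ _ ij xij) (a2 _ _ _ ij xij) subrr.
Qed.

Fact lact0 x : rho x 0 = 0.
Proof. by have := lact_linearr rho x (-1) 0 0; rewrite !scaleN1r oppr0 addr0 addNr. Qed.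

Fact lactB x u v : rho x (u - v) = rho x u - rho x v.
Proof.
by rewrite addrC -scaleN1r lact_linearr scaleN1r addrC.
Qed.

Fact codiffB n f1 f2 : @codiff n (f1 - f2) = codiff f1 - codiff f2.
Proof.
apply/funext => x; rewrite /codiff !fctE opprD addrACA -sumrB; congr (_ + _).
  by apply: eq_bigr => i _; rewrite lactB scalerBr.
case: n f1 f2 x => [|n] f1 f2 x /=; first by rewrite subr0.
rewrite -sumrB; apply: eq_bigr => j _; rewrite -sumrB.
by apply: eq_bigr => i _; rewrite scalerBr.
Qed.

Fact codiff0 n : @codiff n 0 = 0.
Proof. by rewrite -(subrr 0) codiffB subrr. Qed.

Fact cocycle0 n : @cocycle n 0.
Proof. by split; [exact: cochain0|exact: codiff0]. Qed.

Fact cocycleB n f1 f2 : @cocycle n f1 -> @cocycle n f2 -> cocycle (f1 - f2).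
Proof.
move=> [c1 d1] [c2 d2]; split; first exact: cochainB.
by rewrite codiffB d1 d2 subrr.
Qed.

Fact coboundary0 n : @coboundary n 0.
Proof. by case: n => //= n; exists 0; [exact: cochain0|exact: codiff0]. Qed.

Fact coboundaryB n f1 f2 :
  @coboundary n f1 -> @coboundary n f2 -> coboundary (f1 - f2).
Proof.
case: n f1 f2 => [f1 f2 /= -> ->|n _ _ /= [f1 c1 <-] [f2 c2 <-]].
  by rewrite subrr.
by exists (f1 - f2); [exact: cochainB|exact: codiffB].
Qed.

Definition cocycles n := Subgroup (cocycle0 n) (@cocycleB n).
Definition coboundaries n := Subgroup (coboundary0 n) (@coboundaryB n).

Definition cohomology n := subquot (cocycles n) (coboundaries n).

End Cochains.

Section Pullback.
Context (K : fieldType) (g h : lieAlgType K) (phi : {lie g -> h}).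
Context (M : lmodType K) (rho : lieModule h M).

Definition copull n (f : {ffun 'I_n -> h} -> M) (x : {ffun 'I_n -> g}) : M :=
  f (tmap phi x).

Lemma copull_cochain n f : cochain f -> cochain (@copull n f).
Proof.
move=> [lf af]; split=> [x i a u v|x i j ij xij]; rewrite /copull.
  by rewrite !tmap_set linearP lf.
by rewrite (af _ _ _ ij)// !ffunE xij.
Qed.

Lemma copull_codiff n f :
  codiff (lrestrict phi rho) (@copull n f) = copull (codiff rho f).
Proof.
apply/funext => x; rewrite /codiff /copull; congr (_ + _).
  by apply: eq_bigr => i _; rewrite tmap_omit ffunE.
case: n f x => //= n f x; apply: eq_bigr => j _; apply: eq_bigr => i _.
by rewrite tmap_bracket.
Qed.

Lemma copull_cocycle n f :
  cocycles rho n f -> cocycles (lrestrict phi rho) n (copull f).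
Proof.
move=> [cf df]; split; first exact: copull_cochain.
by rewrite copull_codiff df.
Qed.

Lemma copull_coboundary n f1 f2 :
  coboundaries rho n (f1 - f2) ->
  coboundaries (lrestrict phi rho) n (copull f1 - copull f2).
Proof.
case: n f1 f2 => [f1 f2 /= /eqP|n f1 f2 /= [f cf ff]].
  by rewrite subr_eq0 => /eqP ->; rewrite subrr.
exists (copull f); first exact: copull_cochain.
by rewrite copull_codiff ff.
Qed.

(* phi^* : H^n(h, M) -> H^n(g, M) *)
Definition cohomology_map n :
    cohomology rho n -> cohomology (lrestrict phi rho) n :=
  sqmap (coboundaries (lrestrict phi rho) n) (@copull_cocycle n).

Lemma cohomology_mapE n f (Zf : cocycles rho n f) :
  cohomology_map (sqclass (coboundaries rho n) Zf) =
  sqclass (coboundaries (lrestrict phi rho) n) (copull_cocycle Zf).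
Proof. exact: sqmapE (@copull_coboundary n) _ _. Qed.

End Pullback.

Section FreeLinear.
Context (K : fieldType) (T : choiceType) (M : lmodType K) (f : T -> M).

Fact fgliftB u v : fglift f (u - v) = fglift f u - fglift f v.
Proof. exact: lift_is_additive. Qed.

Fact fglift0 : fglift f (0 : {freeg T / K}) = 0.
Proof. by rewrite -(subrr 0) fgliftB subrr. Qed.

Fact fgliftD u v : fglift f (u + v) = fglift f u + fglift f v.
Proof. by rewrite -[v in LHS]opprK fgliftB -[- v]add0r fgliftB fglift0 sub0r opprK. Qed.

Fact fglift_sum I (r : seq I) (P : pred I) (F : I -> {freeg T / K}) :
  fglift f (\sum_(i <- r | P i) F i) = \sum_(i <- r | P i) fglift f (F i).
Proof. exact: (big_morph _ fgliftD fglift0). Qed.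

Fact fgliftZ a u : fglift f (a *: u) = a *: fglift f u.
Proof.
have -> : a *: u = \sum_(z <- dom u) << a * coeff z u *g z >> by [].
have -> : fglift f u = \sum_(z <- dom u) coeff z u *: f z.
  by rewrite -{1}(freeg_sumE u) fglift_sum; apply: eq_bigr => z _; rewrite liftU.
by rewrite fglift_sum scaler_sumr; apply: eq_bigr => z _; rewrite liftU scalerA.
Qed.

End FreeLinear.

Inductive linspan (K : fieldType) (V : lmodType K) (S : set V) : set V :=
| linspan0 : linspan S 0
| linspanZD a u v : S u -> linspan S v -> linspan S (a *: u + v).

Section Linspan.
Context (K : fieldType) (V : lmodType K) (S : set V).

Fact linspanD u v : linspan S u -> linspan S v -> linspan S (u + v).
Proof.
move=> Su Sv; elim: Su => [|a u1 u2 Su1 _ IH]; first by rewrite add0r.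
by rewrite -addrA; apply: linspanZD.
Qed.

Fact linspanN u : linspan S u -> linspan S (- u).
Proof.
elim=> [|a u1 u2 Su1 _ IH]; first by rewrite oppr0; exact: linspan0.
by rewrite opprD -scaleNr; apply: linspanZD.
Qed.

Fact linspanB u v : linspan S u -> linspan S v -> linspan S (u - v).
Proof. by move=> Su Sv; apply: linspanD => //; exact: linspanN. Qed.

End Linspan.

Section Chains.
Context (K : fieldType) (g : lieAlgType K) (M : lmodType K).
Implicit Type n : nat.

Definition prechain n := {freeg ({ffun 'I_n -> g} * M) / K}.

Definition chgen n (x : {ffun 'I_n -> g}) (m : M) : prechain n := << (x, m) >>.

Inductive relator n : set (prechain n) :=
| relator_linl x i a u v m :
    relator (chgen (tset x i (a *: u + v)) m
             - (a *: chgen (tset x i u) m + chgen (tset x i v) m))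
| relator_alt (x : {ffun 'I_n -> g}) i j m : i != j -> x i = x j -> relator (chgen x m)
| relator_linr x a m m' :
    relator (chgen x (a *: m + m') - (a *: chgen x m + chgen x m')).

(* The Chevalley-Eilenberg chains \Lambda^n g \otimes_K M are the quotient of
   prechain n, the free K-space on the symbols x_1 /\ .. /\ x_n (x) m, by
   nullchain n. Cycles and boundaries are taken as their preimages in
   prechain n, so that chcycle contains nullchain, chboundary is the image of
   chdiff plus nullchain, and the quotient of the two is H_n(g, M). *)
Definition nullchain n : set (prechain n) := linspan (@relator n).

Context (rho : lieModule g M).

Definition chbracket n : {ffun 'I_n.+1 -> g} -> M -> prechain n :=
  match n with
  | 0 => fun _ _ => 0
  | k.+1 => fun x m => \sum_(j < k.+2) \sum_(i < k.+1 | (i < j)%N)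
                         (-1) ^+ (i + j) *: chgen (tbracket j i x) m
  end.

(* For a left module:
     d(x_0 /\ .. /\ x_n (x) m)
     = \sum_i (-1)^(i+1) x_0 /\ .. omit x_i .. /\ x_n (x) x_i m
       + \sum_(i < j) (-1)^(i+j)
           [x_i, x_j] /\ x_0 /\ .. omit x_i, x_j .. /\ x_n (x) m. *)
Definition chdiff n : prechain n.+1 -> prechain n :=
  fglift (fun xm => \sum_(i < n.+1)
    (-1) ^+ i.+1 *: chgen (tomit i xm.1) (rho (xm.1 i) xm.2)
    + chbracket xm.1 xm.2).

Definition chcycle n : set (prechain n) :=
  match n with
  | 0 => setT
  | k.+1 => [set c | nullchain (chdiff c)]
  end.

Definition chboundary n : set (prechain n) :=
  [set c | exists b : prechain n.+1, nullchain (c - chdiff b)].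

Fact chcycle0 n : @chcycle n 0.
Proof. by case: n => //= n; rewrite /chdiff fglift0; exact: linspan0. Qed.

Fact chcycleB n c1 c2 : @chcycle n c1 -> @chcycle n c2 -> chcycle (c1 - c2).
Proof.
by case: n c1 c2 => //= n c1 c2 Z1 Z2; rewrite /chdiff fgliftB; exact: linspanB.
Qed.

Fact chboundary0 n : @chboundary n 0.
Proof. by exists 0; rewrite /chdiff fglift0 subrr; exact: linspan0. Qed.

Fact chboundaryB n c1 c2 :
  @chboundary n c1 -> @chboundary n c2 -> chboundary (c1 - c2).
Proof.
move=> [b1 B1] [b2 B2]; exists (b1 - b2); rewrite /chdiff fgliftB.
rewrite (_ : _ - _ = (c1 - chdiff b1) - (c2 - chdiff b2)); first exact: linspanB.
by rewrite !opprD !opprK addrACA.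
Qed.

Definition chcycles n := Subgroup (chcycle0 n) (@chcycleB n).
Definition chboundaries n := Subgroup (chboundary0 n) (@chboundaryB n).

Definition homology n := subquot (chcycles n) (chboundaries n).

End Chains.

Section Pushforward.
Context (K : fieldType) (g h : lieAlgType K) (phi : {lie g -> h}).
Context (M : lmodType K) (rho : lieModule h M).

Definition chpush n : prechain g M n -> prechain h M n :=
  fglift (fun xm => chgen (tmap phi xm.1) xm.2).

Lemma chpush_gen n x m :
  chpush (@chgen _ _ M n x m) = chgen (tmap phi x) m.
Proof. by rewrite /chpush liftU scale1r. Qed.

Lemma chpush_nullchain n c : nullchain c -> nullchain (@chpush n c).
Proof.
rewrite /chpush; elim=> [|a u v Ru _ IH].
  by rewrite fglift0; exact: linspan0.
rewrite fgliftD fgliftZ; apply: linspanZD => //; case: Ru => {a u v IH}.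
- move=> x i a u v m; rewrite fgliftB fgliftD fgliftZ -/(@chpush n).
  by rewrite !chpush_gen !tmap_set linearP; exact: relator_linl.
- move=> x i j m ij xij; rewrite -/(@chpush n) chpush_gen.
  by apply: (relator_alt _ ij); rewrite !ffunE xij.
- move=> x a m m'; rewrite fgliftB fgliftD fgliftZ -/(@chpush n).
  by rewrite !chpush_gen; exact: relator_linr.
Qed.

Lemma chpush_chdiff n c :
  chpush (chdiff (lrestrict phi rho) c) = chdiff rho (@chpush n.+1 c).
Proof.
rewrite -(freeg_sumE c) /chdiff /chpush !fglift_sum.
apply: eq_bigr => -[x m] _; rewrite !liftU !fgliftZ; congr (_ *: _).
rewrite liftU scale1r fgliftD fglift_sum /=; congr (_ + _).
  apply: eq_bigr => i _; rewrite fgliftZ -/(@chpush n) chpush_gen.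
  by rewrite tmap_omit ffunE.
case: n x {c} => [|n] x /=; first by rewrite fglift0.
rewrite fglift_sum; apply: eq_bigr => j _; rewrite fglift_sum.
apply: eq_bigr => i _.
by rewrite fgliftZ -/(@chpush n.+1) chpush_gen tmap_bracket.
Qed.

Lemma chpush_chcycle n c :
  chcycles (lrestrict phi rho) n c -> chcycles rho n (chpush c).
Proof.
case: n c => //= n c Zc; rewrite -chpush_chdiff.
exact: chpush_nullchain.
Qed.

Lemma chpush_chboundary n c1 c2 :
  chboundaries (lrestrict phi rho) n (c1 - c2) ->
  chboundaries rho n (chpush c1 - chpush c2).
Proof.
move=> [b Bb]; exists (chpush b).
rewrite -chpush_chdiff /chpush -!fgliftB.
exact: chpush_nullchain.
Qed.

(* phi_* : H_n(g, M) -> H_n(h, M) *)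
Definition homology_map n :
    homology (lrestrict phi rho) n -> homology rho n :=
  sqmap (chboundaries rho n) (@chpush_chcycle n).

Lemma homology_mapE n c (Zc : chcycles (lrestrict phi rho) n c) :
  homology_map (sqclass (chboundaries (lrestrict phi rho) n) Zc) =
  sqclass (chboundaries rho n) (chpush_chcycle Zc).
Proof. exact: sqmapE (@chpush_chboundary n) _ _. Qed.

End Pushforward.

Arguments homology_map {K g h} phi {M rho n} _.

(* For sets of naturals the supremum lies in {0, 1, 2, ..} \cup {+oo}: an
   unbounded set has +oo as its only upper bound, and the default value 0 is
   used for the empty set only. *)
Definition natsup (A : set nat) : \bar int :=
  supremum 0%:E [set n%:Z%:E | n in A].

Section Dimension.
Context (K : fieldType) (g h : lieAlgType K) (phi : {lie g -> h}).

Definition cd : \bar int :=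
  natsup [set n | exists (M : lmodType K) (rho : lieModule h M)
                         (x : cohomology rho n), cohomology_map phi x != 0].

Definition hd : \bar int :=
  natsup [set n | exists (M : lmodType K) (rho : lieModule h M)
                         (x : homology (lrestrict phi rho) n), homology_map phi x != 0].

End Dimension.

(* Main.v *)
Require Import Defs.
From HB Require Import structures.
From mathcomp Require Import freeg.
From mathcomp Require Import all_boot all_order all_algebra.
From mathcomp Require Import boolp classical_sets functions constructive_ereal.

(** Over a field, the contragredient dual [M'] of an [h]-module [M] satisfies
    [H^n(g, M') = Hom(H_n(g, M), K)], naturally in [g]. Hence if [phi_*] is
    nonzero on [H_n(-, M)] then its transpose [phi^*] is nonzero on [H^n(-, M')],
    and the set whose supremum is [hd phi] is contained in the one for [cd phi].
    Concretely, if [c] is a cycle whose image under [phi] is not a boundary,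
    choose a linear functional on chains that kills all boundaries but not this
    image; it is a cocycle with values in [M'] whose restriction to [g] pairs
    nontrivially with [c]. *)

Set Implicit Arguments.
Unset Strict Implicit.
Unset Printing Implicit Defensive.

Import Order.TTheory GRing.Theory Num.Theory.

Local Open Scope ring_scope.
Local Open Scope quotient_scope.
Local Open Scope classical_set_scope.

(** * Suprema of sets of naturals and their monotonicity *)

Section NatSup.
Implicit Types A B : set nat.

(** [supremum] selects an element of the set of suprema, so one must be exhibited: the maximum of a
    bounded set, and [+oo] for an unbounded one. *)
Lemma natsupP A : A !=set0 -> supremums [set n%:Z%:E | n in A] (natsup A).
Proof.
move=> [n0 An0]; rewrite /natsup /supremum ifF; last first.
  by apply/eqP => /seteqP[/(_ n0%:Z%:E)] + _; apply; exists n0.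
apply: xgetPex; have [[N AN]|nbA] := pselect (exists N, forall n, A n -> (n <= N)%N).
  have exA : exists n, `[< A n >] by exists n0; apply/asboolP.
  have ubA n : `[< A n >] -> (n <= N)%N by move=> /asboolP; exact: AN.
  case: (ex_maxnP exA ubA) => m /asboolP Am mmax; exists m%:Z%:E; split.
    by move=> _ [n An <-]; rewrite lee_fin lez_nat; apply: mmax; apply/asboolP.
  by move=> u uA; apply: uA; exists m.
exists +oo%E; split=> [x _|u uA]; first exact: leey.
have ubA n : A n -> (n%:Z%:E <= u)%E by move=> An; apply: uA; exists n.
(* A finite upper bound [z] would bound [A] by the natural number [|z|], and [-oo] is excluded by
   [n0]. *)
case: u {uA} ubA => [z|//|/(_ _ An0)//] zA; case: nbA; exists `|z|%N => n /zA.
by rewrite lee_fin -lez_nat => /le_trans; apply; rewrite abszE ler_norm.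
Qed.

Lemma natsup0 : natsup set0 = 0%E.
Proof. by rewrite /natsup image_set0 /supremum eqxx. Qed.

Lemma natsup_ge0 A : (0 <= natsup A)%E.
Proof.
have [->|/set0P A0] := eqVneq A set0; first by rewrite natsup0.
have [n An] := A0; have [ubA _] := natsupP A0.
by apply: le_trans (ubA _ _); last by exists n.
Qed.

Lemma le_natsup A B : A `<=` B -> (natsup A <= natsup B)%E.
Proof.
move=> AB; have [->|/set0P A0] := eqVneq A set0.
  (* The default value 0 of the empty set lies below every [natsup]. *)
  by rewrite natsup0 natsup_ge0.
have [_ lubA] := natsupP A0.
have [ubB _] := natsupP (subset_nonempty AB A0).
by apply: lubA => _ [n /AB Bn <-]; apply: ubB; exists n.
Qed.

End NatSup.

Lemma linear_scalable (K : fieldType) (U V : lmodType K) (f : U -> V) :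
  linear f -> forall a u, f (a *: u) = a *: f u.
Proof.
move=> lf a u; rewrite -[a *: u in LHS]addr0 lf.
by rewrite (_ : f 0 = 0) ?addr0// -[X in f X](addNr 0) -scaleN1r lf scaleN1r addNr.
Qed.

(** Such a set is either empty or a subspace; [W 0] is assumed separately where a subspace is
    meant. *)
Definition linclosed (K : fieldType) (V : lmodType K) (W : set V) :=
  forall a u v, W u -> W v -> W (a *: u + v).

(** * Separating a vector from a subspace by a linear functional *)

Section Separation.
Context (K : fieldType) (V : lmodType K).
Implicit Types W : set V.

Let linclosedN W u : linclosed W -> W u -> W 0 -> W (- u).
Proof. by move=> lW Wu W0; rewrite -[- u]addr0 -scaleN1r; exact: lW. Qed.

(* The sets [A] are compared after adjoining [W], so that the union of the
   empty chain is also admissible for Zorn's lemma. *)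
Lemma ex_maximal_linclosed W v : linclosed W -> ~ W v ->
  exists2 W', W `<=` W' & [/\ linclosed W', ~ W' v &
    forall X, W' `<=` X -> linclosed X -> ~ X v -> X `<=` W'].
Proof.
move=> lW Wv.
pose P (A : set V) := linclosed (A `|` W) /\ ~ (A `|` W) v.
have [F FP Ftot|A [[lA Av] Amax]] := @Zorn_bigcup V P.
  split; last by move=> [[A FA Av]|//]; have [_] := FP A FA; apply; left.
  move=> a u w [[A FA Au]|Wu] [[B FB Bw]|Ww]; last by right; exact: lW.
  (* Two vectors from different members of the chain both lie in the larger member. *)
  - have [AB|BA] := Ftot _ _ FA FB.
      have [lB _] := FP _ FB.
      by case: (lB a u w) => [||?|?]; [left; exact: AB|left|left; exists B|right].
    have [lA _] := FP _ FA.
    by case: (lA a u w) => [||?|?]; [left|left; exact: BA|left; exists A|right].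
  - have [lA _] := FP _ FA.
    by case: (lA a u w) => [||?|?]; [left|right|left; exists A|right].
  - have [lB _] := FP _ FB.
    by case: (lB a u w) => [||?|?]; [right|left|left; exists B|right].
exists (A `|` W); first by move=> x; right.
split=> // X AX lX Xv x Xx; apply: contrapT => Ax.
have XW : X `|` W = X by apply/setUidPl => y Wy; apply: AX; right.
apply: (Amax X); last by rewrite /P XW.
split; first by move=> y Ay; apply: AX; left.
by move=> XA; apply: Ax; left; exact: XA.
Qed.

(* A maximal subspace avoiding [v] is a complement of [K v]; the functional is
   the coordinate along [v]. *)
Lemma ex_separating_functional W v : W 0 -> linclosed W -> ~ W v ->
  exists l : V -> K^o, [/\ linear l, forall w, W w -> l w = 0 & l v != 0].
Proof.
move=> W0 lW Wv; have [H WH [lH Hv Hmax]] := ex_maximal_linclosed lW Wv.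
have H0 : H 0 by exact: WH.
have HZ a u : H u -> H (a *: u) by move=> Hu; rewrite -[_ *: _]addr0; exact: lH.
have HD u w : H u -> H w -> H (u + w).
  by move=> Hu Hw; rewrite -[u]scale1r; exact: lH.
have HZv a : H (a *: v) -> a = 0.
  move=> Hav; apply/eqP/negPn/negP => a0; apply: Hv.
  by rewrite -[v]scale1r -(mulVf a0) -scalerA; exact: HZ.
have exl u : exists a : K, H (u - a *: v).
  have [Hu|Hu] := pselect (H u); first by exists 0; rewrite scale0r subr0.
  (* [X] is [H + K u]. It strictly contains [H], so by maximality it contains [v]; solving [v - b u]
     in [H] for [u] gives the coefficient [b^-1]. *)
  pose X : set V := [set x | exists a : K, H (x - a *: u)].
  have HX : H `<=` X by move=> x Hx; exists 0; rewrite scale0r subr0.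
  have lX : linclosed X.
    move=> a x y [b Hb] [c Hc]; exists (a * b + c).
    have := lH a _ _ Hb Hc; congr (H _).
    by rewrite scalerBr scalerA scalerDl opprD addrACA.
  have [[b Hb]|Xv] := pselect (X v); last first.
    have Xu : X u by exists 1; rewrite scale1r subrr.
    by case: Hu; exact: (Hmax X).
  have b0 : b != 0.
    by apply/eqP => b0; apply: Hv; rewrite b0 scale0r subr0 in Hb.
  exists b^-1; have := HZ (- b^-1) _ Hb; congr (H _).
  by rewrite scalerBr !scaleNr opprK scalerA mulVf// scale1r addrC.
have /choice[l Hl] := exl.
(* The coordinate along [v] modulo [H] is unique, hence the function obtained by choice is
   linear. *)
have l_unique u a : H (u - a *: v) -> l u = a.
  move=> Ha; apply/eqP; rewrite -subr_eq0; apply/eqP/HZv.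
  have := HD _ _ Ha (linclosedN lH (Hl u) H0); congr (H _).
  by rewrite opprB addrC addrA subrK scalerBl.
exists l; split=> [a u w|w Ww|].
- apply: l_unique; have := lH a _ _ (Hl u) (Hl w); congr (H _).
  by rewrite scalerBr scalerA scalerDl opprD addrACA.
- by apply: l_unique; rewrite scale0r subr0; exact: WH.
- by rewrite (l_unique v 1) ?oner_eq0// scale1r subrr.
Qed.

End Separation.

(** * The contragredient module *)

Section DualModule.
Context (K : fieldType) (M : lmodType K).

Definition is_linear_form : {pred M -> K^o} := fun f => `[< linear f >].

Fact is_linear_form_closed : submod_closed is_linear_form.
Proof.
split=> [|a f1 f2 /asboolP l1 /asboolP l2]; apply/asboolP => b u v.
  by apply/esym; rewrite -[LHS]/(b *: 0 + 0 : K^o) scaler0 addr0.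
rewrite -[LHS]/(a *: f1 (b *: u + v) + f2 (b *: u + v)) l1 l2.
rewrite -[RHS]/(b *: (a *: f1 u + f2 u) + (a *: f1 v + f2 v)).
by rewrite !scalerDr addrACA !scalerA mulrC.
Qed.

HB.instance Definition _ :=
  GRing.isSubmodClosed.Build K (M -> K^o) is_linear_form is_linear_form_closed.

(** Carved out of the function space [M -> K^o], from which it inherits its pointwise vector space
    structure. *)
Definition dual := {f : M -> K^o | f \in is_linear_form}.
HB.instance Definition _ := SubChoice.on dual.
HB.instance Definition _ := [SubChoice_isSubZmodule of dual by <:].
HB.instance Definition _ := [SubZmodule_isSubLmodule of dual by <:].

Lemma dual_linear (f : dual) : linear (val f).
Proof. exact/asboolP/(valP f). Qed.

Definition to_dual (f : M -> K^o) (lf : linear f) : dual :=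
  Sub f (introT (asboolP _) lf).

Lemma dualP (f1 f2 : dual) : (forall m, val f1 m = val f2 m) -> f1 = f2.
Proof. by move=> f12; apply/val_inj/funext. Qed.

Lemma val_dualZD a (f1 f2 : dual) m :
  val (a *: f1 + f2) m = a *: val f1 m + val f2 m.
Proof. by []. Qed.

Lemma val_dualZ a (f : dual) m : val (a *: f) m = a *: val f m.
Proof. by []. Qed.

Lemma val_dualD (f1 f2 : dual) m : val (f1 + f2) m = val f1 m + val f2 m.
Proof. by []. Qed.

Lemma val_dual_sum I (r : seq I) (P : pred I) (F : I -> dual) m :
  val (\sum_(i <- r | P i) F i) m = \sum_(i <- r | P i) val (F i) m.
Proof. by apply: (big_morph (fun f : dual => val f m)). Qed.

Context (h : lieAlgType K) (rho : lieModule h M).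

Fact dual_act_subproof (x : h) (f : dual) : linear (fun m => - val f (rho x m)).
Proof.
by move=> a u v; rewrite lact_linearr dual_linear opprD scalerN.
Qed.

Definition dual_act x f := to_dual (dual_act_subproof x f).

Fact dual_act_linearl f : linear (dual_act^~ f).
Proof.
move=> a x y; apply: dualP => m; rewrite val_dualZD /=.
by rewrite (lact_linearl rho) dual_linear opprD scalerN.
Qed.

Fact dual_act_linearr x : linear (dual_act x).
Proof.
by move=> a f1 f2; apply: dualP => m; rewrite val_dualZD /= opprD scalerN.
Qed.

(** Transposition reverses the order of composition; the sign in [dual_act] compensates, which makes
    this a left action. *)
Fact dual_act_lie x y f :
  dual_act (lie x y) f = dual_act x (dual_act y f) - dual_act y (dual_act x f).
Proof.
apply: dualP => m /=; rewrite (lact_lie rho) !fctE /=.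
rewrite [rho x _ - _]addrC -scaleN1r dual_linear scaleN1r.
by rewrite opprD !opprK addrC.
Qed.

Definition dual_module : lieModule h dual :=
  LieModule dual_act_linearl dual_act_linearr dual_act_lie.

End DualModule.

(** Comparing the actions pointwise avoids comparing the proofs stored in the two module records,
    and is enough for [codiff]. *)
Lemma lrestrict_dual (K : fieldType) (g h : lieAlgType K) (phi : {lie g -> h})
    (M : lmodType K) (rho : lieModule h M) x f :
  lrestrict phi (dual_module rho) x f = dual_module (lrestrict phi rho) x f.
Proof. exact: dualP. Qed.

(** * The pairing of cochains in the dual with chains *)

Section Pairing.
Context (K : fieldType) (g : lieAlgType K) (M : lmodType K).
Implicit Type n : nat.

Definition pairing n (F : {ffun 'I_n -> g} -> dual M) : prechain g M n -> K^o :=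
  fglift (fun xm => val (F xm.1) xm.2).

Lemma pairing_gen n F x m : @pairing n F (chgen x m) = val (F x) m.
Proof. by rewrite /pairing liftU scale1r. Qed.

(** The three kinds of relators are killed by multilinearity of [F], by its alternation, and by
    linearity of its values. *)
Lemma pairing_nullchain n F c : cochain F -> nullchain c -> @pairing n F c = 0.
Proof.
move=> [lF aF]; elim=> [|a u v Ru _ IH]; first exact: fglift0.
rewrite /pairing fgliftD fgliftZ -/(pairing F) IH addr0.
rewrite (_ : pairing F u = 0) ?scaler0//.
case: Ru => {a u v IH}.
- move=> x i a u v m; rewrite /pairing fgliftB fgliftD fgliftZ -/(pairing F).
  by rewrite !pairing_gen lF val_dualZD subrr.
- by move=> x i j m ij xij; rewrite pairing_gen (aF _ _ _ ij xij).
- move=> x a m m'; rewrite /pairing fgliftB fgliftD fgliftZ -/(pairing F).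
  by rewrite !pairing_gen dual_linear subrr.
Qed.

Lemma pairing_cobracket n F x m :
  @pairing n F (chbracket x m) = val (cobracket F x) m.
Proof.
case: n F x => [|n] F x /=; first by rewrite /pairing fglift0.
rewrite /pairing fglift_sum val_dual_sum; apply: eq_bigr => j _.
rewrite fglift_sum val_dual_sum; apply: eq_bigr => i _.
by rewrite fgliftZ -/(pairing F) pairing_gen val_dualZ.
Qed.

Context (rho : lieModule g M).

Lemma chdiff_gen n (x : {ffun 'I_n.+1 -> g}) (m : M) :
  chdiff rho (chgen x m) = \sum_(i < n.+1)
    (-1) ^+ i.+1 *: chgen (tomit i x) (rho (x i) m) + chbracket x m.
Proof. by rewrite /chdiff liftU scale1r. Qed.

Lemma pairing_chdiff_gen n F x m :
  @pairing n F (chdiff rho (chgen x m)) = val (codiff (dual_module rho) F x) m.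
Proof.
rewrite chdiff_gen /codiff val_dualD -pairing_cobracket.
rewrite {1}/pairing fgliftD fglift_sum val_dual_sum; congr (_ + _).
apply: eq_bigr => i _; rewrite fgliftZ -/(pairing F) pairing_gen val_dualZ /=.
(* The extra sign of [chdiff], with its exponent [i.+1], is the one in the contragredient action. *)
by rewrite exprS mulN1r scaleNr scalerN.
Qed.

Lemma pairing_chdiff n F c :
  @pairing n F (chdiff rho c) = pairing (codiff (dual_module rho) F) c.
Proof.
rewrite -(freeg_sumE c) /chdiff !fglift_sum /pairing !fglift_sum.
apply: eq_bigr => -[x m] _; rewrite !liftU fgliftZ; congr (_ *: _).
by have := pairing_chdiff_gen F x m; rewrite chdiff_gen.
Qed.

(** Adjointness moves the differential onto the cycle, whose boundary is a null chain; in degree 0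
    the only coboundary is zero. *)
Lemma pairing_coboundary n F c :
  coboundaries (dual_module rho) n F -> chcycles rho n c -> pairing F c = 0.
Proof.
case: n F c => [F c /= -> _|n F c /= [E cE <-] Zc].
  rewrite /pairing -(freeg_sumE c) fglift_sum.
  by rewrite big1// => -[x m] _; rewrite liftU scaler0.
by rewrite -pairing_chdiff; exact: pairing_nullchain.
Qed.

Section FunctionalCochain.
Context (n : nat) (l : prechain g M n -> K^o) (ll : linear l).
Hypothesis lnull : forall c, nullchain c -> l c = 0.

Let lrel c : relator c -> l c = 0.
Proof.
move=> Rc; apply: lnull; rewrite -[c]addr0 -[c]scale1r.
by apply: linspanZD => //; exact: linspan0.
Qed.

Let lB u v : l (u - v) = l u - l v.
Proof. by rewrite addrC -scaleN1r ll scaleN1r addrC. Qed.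

Fact functional_cochain_subproof x : linear (fun m => l (chgen x m)).
Proof.
move=> a u v; apply/eqP; rewrite -subr_eq0 -ll -lB.
exact/eqP/lrel/relator_linr.
Qed.

(** Currying, the inverse of [pairing]: functionals vanishing on null chains correspond to cochains
    with values in the dual. *)
Definition functional_cochain x : dual M := to_dual (functional_cochain_subproof x).

Lemma functional_cochainP : cochain functional_cochain.
Proof.
split=> [x i a u v|x i j ij xij]; apply: dualP => m /=.
  apply/eqP; rewrite !fctE /= -subr_eq0 -ll -lB.
  exact/eqP/lrel/relator_linl.
exact/lrel/(relator_alt _ ij xij).
Qed.

Lemma pairing_functional c : pairing functional_cochain c = l c.
Proof.
have l0 : l 0 = 0 by rewrite -(subrr 0) lB subrr.
have lD u v : l (u + v) = l u + l v by rewrite -[u]scale1r ll !scale1r.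
rewrite -(freeg_sumE c) /pairing fglift_sum (big_morph l lD l0).
apply: eq_bigr => -[x m] _; rewrite liftU /= -(linear_scalable ll).
congr (l _); apply/eqP/freeg_eqP => y.
by rewrite coeffZ !coeffU mul1r.
Qed.

End FunctionalCochain.

End Pairing.

(** * Naturality of the pairing along [phi] *)

Section Duality.
Context (K : fieldType) (g h : lieAlgType K) (phi : {lie g -> h}).
Context (M : lmodType K) (rho : lieModule h M).

(** On generators both sides evaluate [F] at the image tuple: pullback of cochains is the transpose
    of pushforward of chains. *)
Lemma pairing_chpush n (F : {ffun 'I_n -> h} -> dual M) (c : prechain g M n) :
  pairing F (chpush phi c) = pairing (copull phi F) c.
Proof.
rewrite -(freeg_sumE c) /pairing /chpush !fglift_sum.
by apply: eq_bigr => -[x m] _; rewrite !liftU fgliftZ liftU scale1r.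
Qed.

Lemma coboundaries_lrestrict_dual n (F : {ffun 'I_n -> g} -> dual M) :
  coboundaries (lrestrict phi (dual_module rho)) n F ->
  coboundaries (dual_module (lrestrict phi rho)) n F.
Proof.
case: n F => //= n F [E cE <-]; exists E => //; apply/funext => x.
rewrite /codiff; congr (_ + _).
by apply: eq_bigr => i _; rewrite -lrestrict_dual.
Qed.

End Duality.

Lemma linclosed_nullchain (K : fieldType) (g : lieAlgType K) (M : lmodType K) n :
  linclosed (@nullchain K g M n).
Proof.
move=> a u v Nu Nv; apply: linspanD => //; elim: Nu => [|b u1 u2 Su1 _ IH].
  by rewrite scaler0; exact: linspan0.
by rewrite scalerDr scalerA; exact: linspanZD.
Qed.

Lemma linclosed_chboundary (K : fieldType) (g : lieAlgType K) (M : lmodType K)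
    (rho : lieModule g M) n :
  linclosed (@chboundary K g M rho n).
Proof.
move=> a u v [bu Bu] [bv Bv]; exists (a *: bu + bv).
have := linclosed_nullchain a Bu Bv; congr (nullchain _).
by rewrite /chdiff fgliftD fgliftZ scalerBr opprD addrACA.
Qed.

Lemma sqclass_eq0 (V : zmodType) (Z B : subgroup V) v (Zv : Z v) :
  sqclass B Zv = 0 <-> B v.
Proof.
have -> : (0 : subquot Z B) = \pi_(subquot Z B) 0 by rewrite piE.
split=> [/eqP|Bv]; last apply/eqP; rewrite -Quotient.idealrBE subr0.
  by move=> /asboolP.
exact/asboolP.
Qed.

Theorem proposition4p6 (K : fieldType) (g h : lieAlgType K)
    (phi : {lie g -> h}) :
  (hd phi <= cd phi)%E.
Proof.
apply: le_natsup => n /= [M [rho [x]]].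
rewrite -[x]reprK; set c := repr x.
have -> : \pi_(homology (lrestrict phi rho) n) c =
    sqclass (chboundaries (lrestrict phi rho) n) (sgtypeP c).
  by congr (\pi_(_) _); exact: val_inj.
rewrite homology_mapE => /eqP/sqclass_eq0 nbc.
have [l [ll lB lc]] :=
  ex_separating_functional (@chboundary0 _ _ _ rho n)
    (@linclosed_chboundary _ _ _ rho n) nbc.
(* A null chain is a boundary, with witness 0, so [l] descends to the Chevalley-Eilenberg chains. *)
have lnull u : nullchain u -> l u = 0.
  by move=> Nu; apply: lB; exists 0; rewrite /chdiff fglift0 subr0.
have lcoc : cocycles (dual_module rho) n (functional_cochain ll lnull).
  split; first exact: functional_cochainP.
  (* By adjointness the codifferential is [l] composed with [chdiff], which vanishes because [l]
     kills boundaries. *)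
  apply/funext => y; apply: dualP => m; rewrite -pairing_chdiff_gen.
  rewrite pairing_functional lB//; exists (chgen y m).
  by rewrite subrr; exact: linspan0.
exists (dual M), (dual_module rho), (sqclass _ lcoc).
rewrite cohomology_mapE; apply/eqP => /sqclass_eq0.
(* If the pullback were a coboundary, it would pair to zero with the cycle [c]; but this pairing is
   [l (chpush phi c)], which is nonzero. *)
move=> /coboundaries_lrestrict_dual/pairing_coboundary/(_ (sgtypeP c)).
by rewrite -pairing_chpush pairing_functional; exact/eqP.
Qed.
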